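(* Let $A\in\mathbb{R}^{m\times n}$ and $b\in\mathbb{R}^m$ be such that $S_+=\{z\in\mathbb{R}^n_+ : Az=b\}$ is nonempty, and let $x_0\in\mathbb{R}^n_{++}$. Let $(x_k)$ be generated by (''Hadamard descent+'') $$\alpha_k=\min\left\{\frac{f(x_k)}{\|\nabla f(x_k)\|^2_{x_k}},\ \frac{1.79}{\|\nabla f(x_k)\|_\infty}\right\},\qquad x_{k+1}=x_k\circ\big(\mathbf{1}-\alpha_k\nabla f(x_k)+\alpha_k^2\nabla f(x_k)^2\big),$$ with $f(x)=\frac12\|Ax-b\|_2^2$ (if $\nabla f(x_k)=0$ the sequence is kept constant from then on). Then $(x_k)$ converges to some $x^*\in S_+$, and for all $k\ge0$ $$\min_{0\le i\le k} f(x_i)\le \frac{4R\,(R+\|x^*\|_1)\max_{j\le n}\|A_{:j}\|_2^2}{k+1},\qquad R=D_h(x^*,x_0).$$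
   Context: $\mathbb{R}^n_{++}$ is the strictly positive orthant; $\circ$ is componentwise multiplication and $\nabla f(x_k)^2$ is the componentwise square; $\mathbf{1}$ the all-ones vector; $\nabla f(x)=A^\top(Ax-b)$; $\|v\|_x^2=\sum_i x_iv_i^2$; $A_{:j}$ is the $j$-th column of $A$. $h(x)=\sum_i x_i(\log x_i-1)$ (with $0\log0=0$) and $D_h(x,y)=\sum_i\big(x_i\log\frac{x_i}{y_i}-x_i+y_i\big)$ for $x\in\mathbb{R}^n_+$, $y\in\mathbb{R}^n_{++}$. *)

(* Defs.v *)
From HB Require Import structures.
From mathcomp Require Import all_boot all_order all_algebra.
From mathcomp Require Import all_classical all_reals all_analysis.
Set Implicit Arguments. Unset Strict Implicit. Unset Printing Implicit Defensive.
Import Order.TTheory GRing.Theory Num.Theory.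
Local Open Scope ring_scope.

Section HD.
Variables (R : realType) (m n : nat) (A : 'M[R]_(m, n)) (b : 'cV[R]_m).

Definition lsq_f (x : 'cV[R]_n) : R :=
  2^-1 * \sum_(i < m) ((A *m x - b) i 0) ^+ 2.

Definition lsq_grad (x : 'cV[R]_n) : 'cV[R]_n := A^T *m (A *m x - b).

End HD.

Definition locnorm2 (R : realType) (n : nat) (x v : 'cV[R]_n) : R :=
  \sum_(i < n) x i 0 * (v i 0) ^+ 2.

Definition supnorm (R : realType) (n : nat) (v : 'cV[R]_n) : R :=
  \big[Num.max/0]_(i < n) `|v i 0|.

Definition l1norm (R : realType) (n : nat) (v : 'cV[R]_n) : R :=
  \sum_(i < n) `|v i 0|.

Definition maxcol2 (R : realType) (m n : nat) (A : 'M[R]_(m, n)) : R :=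
  \big[Num.max/0]_(j < n) \sum_(i < m) (A i j) ^+ 2.

(* Bregman divergence of h(x) = sum x_i (log x_i - 1), with 0 log 0 = 0 *)
Definition Dh (R : realType) (n : nat) (x y : 'cV[R]_n) : R :=
  \sum_(i < n)
    (if x i 0 == 0 then y i 0
     else x i 0 * ln (x i 0 / y i 0) - x i 0 + y i 0).

Definition hd_alpha (R : realType) (m n : nat) (A : 'M[R]_(m, n)) (b : 'cV[R]_m)
  (x : 'cV[R]_n) : R :=
  let g := lsq_grad A b x in
  Num.min (lsq_f A b x / locnorm2 x g) ((179%:R / 100%:R) / supnorm g).

Definition hd_step (R : realType) (m n : nat) (A : 'M[R]_(m, n)) (b : 'cV[R]_m)
  (x : 'cV[R]_n) : 'cV[R]_n :=
  let g := lsq_grad A b x in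
  let a := hd_alpha A b x in
  if g == 0 then x
  else \col_(i < n) (x i 0 * (1 - a * g i 0 + a ^+ 2 * (g i 0) ^+ 2)).

Definition hd_seq (R : realType) (m n : nat) (A : 'M[R]_(m, n)) (b : 'cV[R]_m)
  (x0 : 'cV[R]_n) (k : nat) : 'cV[R]_n :=
  iter k (hd_step A b) x0.

(* Main.v *)
Require Import Defs.
From HB Require Import structures.
From mathcomp Require Import all_boot all_order all_algebra.
From mathcomp Require Import all_classical all_reals all_analysis.
From mathcomp Require Import ring lra.
Set Implicit Arguments. Unset Strict Implicit. Unset Printing Implicit Defensive.
Import Order.TTheory GRing.Theory Num.Theory numFieldNormedType.Exports.
Local Open Scope ring_scope.
Local Open Scope classical_set_scope.

(* The bound exp(s) <= 1 + s + s^2 on [-1.79, 1.79] makes D_h(z, x_k) a Lyapunov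
   function for every nonnegative solution z: one step decreases it by at least
   alpha_k f(x_k).  Hence |x_k|_1 <= 2 (D_h(z, x_0) + |z|_1), which bounds alpha_k
   from below, and summing the decreases gives the rate.  The iterates are bounded
   and f(x_k) -> 0, so a cluster point x* is a nonnegative solution; D_h(x*, x_k)
   is nonincreasing and small at some index, hence tends to 0, and the inequality
   (y - z)^2 <= 2 (y + z) D_h(z, y) turns this into convergence. *)

(** * Polynomial bounds on the exponential *)

(** The derivative of [p(x) exp(- x)] is [(p' - p)(x) exp(- x)], so comparing [expR] with a
    polynomial becomes a polynomial inequality. *)
Lemma horner_mul_expRN_le (R : realType) (p : {poly R}) (a b : R) : a <= b ->
  (forall x, a <= x <= b -> p.[x] <= (p^`()).[x]) ->
  p.[a] * expR (- a) <= p.[b] * expR (- b).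
Proof.
move=> ab h.
have d (x : R) : is_derive x (1:R) (fun y : R => p.[y] * expR (- y))
    (((p^`()).[x] - p.[x]) * expR (- x)).
  have e : is_derive x (1:R) (fun y => expR (- y)) (- expR (- x)).
    have := @is_derive1_comp R expR -%R x _ _ (is_derive_expR _) (is_deriveNid x 1).
    by rewrite mulrN1.
  have := is_deriveM (is_derive_poly p x) e.
  move/is_derive_eq; apply.
  by rewrite /GRing.scale /= mulrBl mulrN addrC mulrC.
apply: (@ger0_derive1_ndecr R (fun y : R => p.[y] * expR (- y)) a b) => //.
- move=> x; rewrite in_itv/= => /andP[x1 x2].
  rewrite derive1E; have [_ ->] := d x.
  by rewrite mulr_ge0 ?expR_ge0 // subr_ge0 h // !ltW.
- apply: derivable_within_continuous => x _; by have [? _] := d x.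
Qed.

(* The Taylor polynomial of degree 7 becomes an upper bound on [0, 1.79] once
   x ^ 7 / 14500 is added: then p' - p = x ^ 6 (7 / 14500 - (1 / 5040 + 1 / 14500) x)
   is nonnegative there, so p(x) exp(- x) increases from 1. *)
Lemma expR_179_le (R : realType) :
  expR (179%:R / 100%:R) <= 1 + 179%:R / 100%:R + (179%:R / 100%:R) ^+ 2 :> R.
Proof.
pose q (x : R) : R := 1 + x + 2^-1 * x ^+ 2 + 6^-1 * x ^+ 3 + 24^-1 * x ^+ 4
  + 120^-1 * x ^+ 5 + 720^-1 * x ^+ 6 + (5040^-1 + 14500^-1) * x ^+ 7.
have [p px dpx] : exists2 p : {poly R}, forall x, p.[x] = q x &
    forall x, (p^`()).[x] = 1 + x + 2^-1 * x ^+ 2 + 6^-1 * x ^+ 3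
    + 24^-1 * x ^+ 4 + 120^-1 * x ^+ 5 + (720^-1 + 7 * 14500^-1) * x ^+ 6.
  exists (1 + 'X + 2^-1 *: 'X^2 + 6^-1 *: 'X^3 + 24^-1 *: 'X^4
    + 120^-1 *: 'X^5 + 720^-1 *: 'X^6 + (5040^-1 + 14500^-1) *: 'X^7) => x.
    by rewrite /q !hornerE.
  by rewrite !poly.derivE !hornerE /=; field.
have q0 : q 0 * expR (- 0) = 1.
  by rewrite oppr0 expR0 mulr1 /q !expr0n /= !mulr0 !addr0.
have qc : q (179%:R / 100%:R) <= 1 + 179%:R / 100%:R + (179%:R / 100%:R) ^+ 2.
  by rewrite /q; clear; lra.
suff h : 1 <= q (179%:R / 100%:R) * expR (- (179%:R / 100%:R)).
  apply: le_trans qc.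
  by move: h; rewrite expRN ler_pdivlMr ?expR_gt0 // mul1r.
rewrite -[X in X <= _]q0 -!px; apply: horner_mul_expRN_le => [|x /andP[x0 x1]].
  by rewrite divr_ge0.
rewrite dpx px -subr_ge0.
have : 0 <= x ^+ 6 * (7 * 14500^-1 - (5040^-1 + 14500^-1) * x).
  apply: mulr_ge0; [by rewrite exprn_ge0 | clear -x1; lra].
congr (_ <= _); rewrite /q; clear.
by move: 2^-1 6^-1 24^-1 120^-1 720^-1 5040^-1 14500^-1 => *; ring.
Qed.

(* (1 + s + s ^ 2) exp(- s) has derivative s (1 - s) exp(- s), hence is at least
   its value 1 at 0 for s <= 1, and decreases afterwards, down to a value
   barely above 1 at s = 1.79. *)
Lemma expR_le_quadratic (R : realType) (s : R) :
  - (179%:R / 100%:R) <= s <= 179%:R / 100%:R -> expR s <= 1 + s + s ^+ 2.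
Proof.
move=> /andP[s1 s2].
have E (x : R) : (1 + 'X + 'X^2).[x] = 1 + x + x ^+ 2 by rewrite !hornerE.
have E' (x : R) : ((1 + 'X + 'X^2)^`()).[x] = 1 + 2 * x.
  by rewrite !poly.derivE !hornerE /=; ring.
suff : 1 <= (1 + s + s ^+ 2) * expR (- s).
  by rewrite expRN ler_pdivlMr ?expR_gt0 // mul1r.
have [s0|s0] := leP s 0.
  have := @horner_mul_expRN_le R (- (1 + 'X + 'X^2)) s 0 s0 _.
  rewrite derivN !hornerN !E !oppr0 expR0 !mulNr lerN2.
  rewrite expr0n /= !addr0 mulr1; apply.
  by move=> x /andP[x1 x2]; rewrite !hornerN lerN2 E E'; nra.
have [s3|s3] := leP s 1.
  have := @horner_mul_expRN_le R ((1 + 'X + 'X^2)) 0 s (ltW s0) _.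
  rewrite !E !oppr0 expR0 expr0n /= !addr0 mulr1; apply.
  by move=> x /andP[x1 x2]; rewrite E E'; nra.
have := @horner_mul_expRN_le R (- (1 + 'X + 'X^2)) s (179%:R / 100%:R) s2 _.
rewrite derivN !hornerN !E !mulNr lerN2 => h.
apply: le_trans (h _).
  by rewrite expRN ler_pdivlMr ?expR_gt0 // mul1r expR_179_le.
by move=> x /andP[x1 x2]; rewrite !hornerN lerN2 E E'; nra.
Qed.

(** * Scalar relative entropy *)

Lemma ln_le_subr1 (R : realType) (t : R) : 0 < t -> ln t <= t - 1.
Proof. by move=> t0; rewrite -{1}(subrKC 1 t) le_ln1Dx //; lra. Qed.

(** One coordinate of [Dh], with the same case split so that [DhE] holds by conversion. *)
Definition kl (R : realType) (z y : R) : R :=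
  if z == 0 then y else z * ln (z / y) - z + y.

(** For [z > 0], with [a], [b] the square roots of [z], [y], this amounts to
    [2 a^2 ln (b / a) <= 2 a^2 (b / a - 1)]. *)
Lemma hellinger_le_kl (R : realType) (z y : R) : 0 <= z -> 0 < y ->
  (Num.sqrt z - Num.sqrt y) ^+ 2 <= kl z y.
Proof.
move=> z0 y0; rewrite /kl; case: eqVneq => [->|zn0].
  by rewrite sqrtr0 sub0r sqrrN sqr_sqrtr // ltW.
have {z0 zn0} z0 : 0 < z by rewrite lt_neqAle eq_sym zn0.
have a0 : 0 < Num.sqrt z by rewrite sqrtr_gt0.
have b0 : 0 < Num.sqrt y by rewrite sqrtr_gt0.
rewrite -[in leRHS](sqr_sqrtr (ltW z0)) -[in leRHS](sqr_sqrtr (ltW y0)).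
move: (Num.sqrt z) (Num.sqrt y) a0 b0 => a b a0 b0.
have ab : 0 < b / a by rewrite divr_gt0.
have -> : a ^+ 2 / b ^+ 2 = (b / a) ^- 2.
  by field; rewrite !gt_eqF.
rewrite lnV ?posrE ?exprn_gt0 // lnXn //.
have h : a ^+ 2 * ln (b / a) <= a ^+ 2 * (b / a - 1).
  by rewrite ler_pM2l ?exprn_gt0 // ln_le_subr1.
have -> : (a - b) ^+ 2 = - (2 * (a ^+ 2 * (b / a - 1))) - a ^+ 2 + b ^+ 2.
  by field; rewrite gt_eqF.
by rewrite lerD2r lerD2r mulrN mulrnAr lerN2 -mulr_natl ler_pM2l.
Qed.

Lemma kl_ge0 (R : realType) (z y : R) : 0 <= z -> 0 < y -> 0 <= kl z y.
Proof. by move=> z0 y0; apply: le_trans (hellinger_le_kl z0 y0); exact: sqr_ge0. Qed.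

(** For the square roots [a], [b] of [z], [y], the left side is [(a - b)^2 (a + b)^2], and
    [(a + b)^2 <= 2 (a^2 + b^2)]. *)
Lemma sqdist_le_kl (R : realType) (z y : R) : 0 <= z -> 0 < y ->
  (y - z) ^+ 2 <= 2 * (y + z) * kl z y.
Proof.
move=> z0 y0; have h := hellinger_le_kl z0 y0.
have c : 0 <= 2 * (y + z) by rewrite mulr_ge0 // addr_ge0 // ltW.
apply: le_trans (ler_wpM2l c h).
move: (Num.sqrt z) (Num.sqrt y) (sqr_sqrtr z0) (sqr_sqrtr (ltW y0)) => a b.
move=> <- <- {c h}.
rewrite -subr_ge0.
have -> : 2 * (b ^+ 2 + a ^+ 2) * (a - b) ^+ 2 - (b ^+ 2 - a ^+ 2) ^+ 2
  = (a - b) ^+ 4 by ring.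
by rewrite exprn_even_ge0.
Qed.

(** Splitting [ln (y / z)] into [ln (y / (2 z)) + ln 2] and using [ln t <= t - 1] on both terms
    bounds [z ln (y / z)] by [y / 2]. *)
Lemma le_kl (R : realType) (z y : R) : 0 <= z -> 0 < y -> y <= 2 * (kl z y + z).
Proof.
move=> z0 y0; rewrite /kl; case: eqVneq => [->|zn0]; first by lra.
have {z0 zn0} z0 : 0 < z by rewrite lt_neqAle eq_sym zn0.
have -> : z / y = (y / z / 2) ^-1 / 2 by field; rewrite !gt_eqF.
have t0 : 0 < y / z / 2 by rewrite !divr_gt0.
rewrite ln_div ?posrE ?invr_gt0 // lnV ?posrE //.
have h1 := ler_wpM2l (ltW z0) (ln_le_subr1 t0).
have h2 : z * ln 2 <= z * (2 - 1) by rewrite ler_pM2l // ln_le_subr1.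
have e : z * (y / z / 2 - 1) = y / 2 - z by field; rewrite !gt_eqF.
move: h1 h2; rewrite e; lra.
Qed.

Lemma hd_factor_gt0 (R : realDomainType) (t : R) : 0 < 1 - t + t ^+ 2.
Proof. nra. Qed.

(** The cap 1.79 of the step size enters here: it allows [expR_le_quadratic] at [- t], hence
    [- t <= ln (1 - t + t^2)]. *)
Lemma kl_hd_factor (R : realType) (z x t : R) : 0 <= z -> 0 < x ->
  `|t| <= 179%:R / 100%:R ->
  kl z (x * (1 - t + t ^+ 2)) - kl z x <= z * t + x * (t ^+ 2 - t).
Proof.
rewrite ler_norml => z0 x0 /andP[t1 t2]; rewrite /kl.
have w0 := hd_factor_gt0 t.
have tw : - t <= ln (1 - t + t ^+ 2).
  rewrite -ler_expR lnK ?posrE //.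
  have := @expR_le_quadratic R (- t); rewrite sqrrN; apply; rewrite lerNr opprK; lra.
case: eqVneq => [->|zn0]; first by lra.
have {z0 zn0} z0 : 0 < z by rewrite lt_neqAle eq_sym zn0.
have -> : z / (x * (1 - t + t ^+ 2)) = z / x / (1 - t + t ^+ 2).
  by field; rewrite !gt_eqF.
rewrite (ln_div _ w0) ?posrE ?divr_gt0 //.
have := ler_wpM2l (ltW z0) tw; lra.
Qed.

(** For [z = 0] the divergence is [y t] itself; otherwise [ln] is continuous at 1. The filter is
    general so that an ultrafilter can be used. *)
Lemma cvg_kl0 (R : realType) (T : Type) (F : set_system T) (y : T -> R) (z : R) :
  Filter F -> 0 <= z -> y @ F --> z -> kl z (y t) @[t --> F] --> (0 : R).
Proof.
move=> FF z0 yz; rewrite /kl; case: eqVneq => [z0'|zn0]; first by rewrite -z0'.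
have zp : 0 < z by rewrite lt_neqAle eq_sym zn0.
have -> : 0 = z * ln (z / z) - z + z by rewrite divff // ln1; ring.
apply: cvgD => //; apply: cvgB; last exact: cvg_cst.
apply: cvgM; first exact: cvg_cst.
apply: continuous_cvg; first by apply: continuous_ln; rewrite divr_gt0.
by apply: cvgM; [exact: cvg_cst|exact: cvgV].
Qed.

(** * Cauchy-Schwarz and bounds on the least-squares gradient *)

(** The sum of the squares [(V u_i - P v_i)^2] equals [V (U V - P^2)]; the case [V = 0] forces
    [v = 0]. *)
Lemma sum_cauchy_schwarz (R : realFieldType) (I : finType) (u v : I -> R) :
  (\sum_i u i * v i) ^+ 2 <= (\sum_i u i ^+ 2) * \sum_i v i ^+ 2.
Proof.
set U := \sum_i u i ^+ 2; set V := \sum_i v i ^+ 2; set P := \sum_i u i * v i.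
have V0 : 0 <= V by apply: sumr_ge0 => i _; exact: sqr_ge0.
have [Vz|Vn] := eqVneq V 0.
  have v0 i : v i = 0.
    apply/eqP; rewrite -sqrf_eq0; apply/eqP.
    by apply: (psumr_eq0P _ Vz) => // j _; exact: sqr_ge0.
  by rewrite /P big1 ?expr0n ?Vz ?mulr0 // => i _; rewrite v0 mulr0.
have : 0 <= \sum_i (V * u i - P * v i) ^+ 2.
  by apply: sumr_ge0 => i _; exact: sqr_ge0.
have -> : \sum_i (V * u i - P * v i) ^+ 2 = V * (U * V - P ^+ 2).
  under eq_bigr => i _.
    have -> : (V * u i - P * v i) ^+ 2 = V ^+ 2 * u i ^+ 2
      + (- (2 * V * P)) * (u i * v i) + P ^+ 2 * v i ^+ 2 by ring.
    over.
  rewrite !big_split -!mulr_sumr -/U -/V -/P /=; ring.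
by rewrite pmulr_rge0 ?subr_ge0 // lt_neqAle eq_sym Vn.
Qed.

Section LeastSquares.
Variables (R : realType) (m n : nat) (A : 'M[R]_(m, n)) (b : 'cV[R]_m).
Implicit Types x z : 'cV[R]_n.
Local Notation f := (lsq_f A b).
Local Notation g := (lsq_grad A b).
Local Notation L := (maxcol2 A).

Lemma maxcol2_ge0 : 0 <= L.
Proof. by rewrite /maxcol2 bigmax_ge_id. Qed.

Lemma col_le_maxcol2 j : \sum_k A k j ^+ 2 <= L.
Proof. by rewrite /maxcol2 (le_bigmax _ (fun j => \sum_k A k j ^+ 2)). Qed.

Lemma l1norm_ge0 x : 0 <= l1norm x.
Proof. by apply: sumr_ge0. Qed.

Lemma lsq_f_ge0 x : 0 <= f x.
Proof.
by rewrite mulr_ge0 ?invr_ge0 // sumr_ge0 // => i _; rewrite sqr_ge0.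
Qed.

Lemma lsq_gradE x i : g x i 0 = \sum_k A k i * (A *m x - b) k 0.
Proof. by rewrite mxE; apply: eq_bigr => k _; rewrite !mxE. Qed.

Lemma lsq_f_eq0 x : f x = 0 -> A *m x = b.
Proof.
move=> /eqP; rewrite mulf_eq0 invr_eq0 pnatr_eq0 /= => /eqP h.
apply/eqP; rewrite -subr_eq0; apply/eqP/colP => i; rewrite [RHS]mxE.
apply/eqP; rewrite -sqrf_eq0; apply/eqP.
by apply: (psumr_eq0P _ h) => // j _; exact: sqr_ge0.
Qed.

(** Moving [A^T] across the pairing gives the inner product of [A x - b] with [A (x - z)], and these
    vectors coincide. *)
Lemma lsq_grad_inner x z : A *m z = b ->
  \sum_i g x i 0 * (x i 0 - z i 0) = 2 * f x.
Proof.
move=> Az; transitivity (((g x)^T *m (x - z)) 0 0).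
  by rewrite mxE; apply: eq_bigr => i _; rewrite !mxE.
rewrite /lsq_grad trmx_mul trmxK -mulmxA mulmxBr Az mxE mulrA divff ?mul1r //.
by apply: eq_bigr => i _; rewrite !mxE -expr2.
Qed.

(** Cauchy-Schwarz between column [i] and the residual, whose squared norm is [2 f x]. *)
Lemma lsq_grad_sqr_le x i : (g x i 0) ^+ 2 <= 2 * L * f x.
Proof.
rewrite lsq_gradE (le_trans (sum_cauchy_schwarz _ _)) //.
rewrite [2 * L]mulrC -mulrA [2 * f x]mulrA divff // mul1r.
by rewrite ler_wpM2r ?col_le_maxcol2 // sumr_ge0 // => k _; rewrite sqr_ge0.
Qed.

Lemma gram_le_maxcol2 i j : `|\sum_k A k i * A k j| <= L.
Proof.
rewrite -(@ler_pXn2r R 2) ?nnegrE ?maxcol2_ge0 // real_normK ?num_real //.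
rewrite (le_trans (sum_cauchy_schwarz _ _)) // expr2.
by rewrite ler_pM ?col_le_maxcol2 // sumr_ge0 // => k _; rewrite sqr_ge0.
Qed.

(** As [b = A z], the gradient is [A^T A (x - z)], and the entries of [A^T A] are at most [L] in
    absolute value. *)
Lemma lsq_grad_abs_le x z i : A *m z = b ->
  `|g x i 0| <= L * (l1norm x + l1norm z).
Proof.
move=> Az.
have -> : g x i 0 = \sum_j (\sum_k A k i * A k j) * (x j 0 - z j 0).
  rewrite lsq_gradE -Az -mulmxBr.
  under eq_bigr => k _ do rewrite [(A *m _) k 0]mxE mulr_sumr.
  rewrite exchange_big; apply: eq_bigr => j _; rewrite mulr_suml.
  by apply: eq_bigr => k _; rewrite !mxE mulrA.
rewrite (le_trans (ler_norm_sum _ _ _)) // /l1norm -big_split mulr_sumr.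
rewrite ler_sum //= => j _.
by rewrite normrM ler_pM ?gram_le_maxcol2 // ler_normB.
Qed.

End LeastSquares.

(** * The divergence [Dh] on vectors *)

Section Entropy.
Variables (R : realType) (n : nat).
Implicit Types x z : 'cV[R]_n.

Lemma DhE z x : Dh z x = \sum_i kl (z i 0) (x i 0).
Proof. by []. Qed.

Lemma Dh_ge0 z x : (forall i, 0 <= z i 0) -> (forall i, 0 < x i 0) -> 0 <= Dh z x.
Proof. by move=> z0 x0; apply: sumr_ge0 => i _; exact: kl_ge0. Qed.

Lemma l1norm_le_Dh z x : (forall i, 0 <= z i 0) -> (forall i, 0 < x i 0) ->
  l1norm x <= 2 * (Dh z x + l1norm z).
Proof.
move=> z0 x0; rewrite DhE /l1norm -big_split mulr_sumr ler_sum //= => i _.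
by rewrite gtr0_norm // ger0_norm // le_kl.
Qed.

Lemma le_Dh z x i : (forall i, 0 <= z i 0) -> (forall i, 0 < x i 0) ->
  kl (z i 0) (x i 0) <= Dh z x.
Proof.
move=> z0 x0; rewrite DhE (bigD1 i) //= lerDl sumr_ge0 // => j _.
exact: kl_ge0.
Qed.

End Entropy.

(** * Decrease of the divergence in one step *)

Section Descent.
Variables (R : realType) (m n : nat) (A : 'M[R]_(m, n)) (b : 'cV[R]_m).
Implicit Types x z : 'cV[R]_n.
Local Notation f := (lsq_f A b).
Local Notation g := (lsq_grad A b).
Local Notation L := (maxcol2 A).
Local Notation step := (hd_step A b).
Local Notation alpha := (hd_alpha A b).

Lemma hd_step_gt0 x : (forall i, 0 < x i 0) -> forall i, 0 < step x i 0.
Proof.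
move=> x0 i; rewrite /hd_step; case: ifP => // _; rewrite mxE.
by rewrite mulr_gt0 // -exprMn hd_factor_gt0.
Qed.

Lemma supnorm_gt0 (v : 'cV[R]_n) : v != 0 -> 0 < supnorm v.
Proof.
case/cV0Pn => i vi; apply: lt_le_trans (le_bigmax _ (fun i => `|v i 0|) i).
by rewrite normr_gt0.
Qed.

Lemma locnorm2_gt0 x (v : 'cV[R]_n) : (forall i, 0 < x i 0) -> v != 0 ->
  0 < locnorm2 x v.
Proof.
move=> x0 /cV0Pn[i vi]; rewrite /locnorm2 (bigD1 i) //= ltr_pwDl //.
  by rewrite mulr_gt0 // lt_neqAle eq_sym sqrf_eq0 vi sqr_ge0.
by rewrite sumr_ge0 // => j _; rewrite mulr_ge0 ?sqr_ge0 // ltW.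
Qed.

Lemma hd_alpha_ge0 x : (forall i, 0 < x i 0) -> g x != 0 -> 0 <= alpha x.
Proof.
move=> x0 gn; rewrite /hd_alpha le_min !divr_ge0 ?lsq_f_ge0 // ltW //.
  exact: supnorm_gt0.
exact: locnorm2_gt0.
Qed.

Lemma hd_alpha_abs_le x i : (forall i, 0 < x i 0) -> g x != 0 ->
  `|alpha x * g x i 0| <= 179%:R / 100%:R.
Proof.
move=> x0 gn; rewrite normrM ger0_norm ?hd_alpha_ge0 //.
have : alpha x <= 179%:R / 100%:R / supnorm (g x).
  by rewrite /hd_alpha ge_min lexx orbT.
rewrite ler_pdivlMr ?supnorm_gt0 //; apply: le_trans.
apply: ler_wpM2l; first exact: hd_alpha_ge0.
exact: (le_bigmax _ (fun i => `|g x i 0|) i).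
Qed.

Lemma hd_alpha_locnorm2_le x : (forall i, 0 < x i 0) -> g x != 0 ->
  alpha x * locnorm2 x (g x) <= f x.
Proof.
move=> x0 gn; rewrite -ler_pdivlMr ?locnorm2_gt0 //.
by rewrite /hd_alpha ge_min lexx.
Qed.

(* The multiplicative update satisfies ln (1 - t + t ^ 2) >= - t with t = a g_i,
   so Dh moves by at most a ^ 2 |g|_x ^ 2 - a <g, x - z>, where <g, x - z> = 2 f x
   and a |g|_x ^ 2 <= f x. *)
Lemma Dh_hd_step x z : (forall i, 0 < x i 0) -> g x != 0 ->
  (forall i, 0 <= z i 0) -> A *m z = b ->
  alpha x * f x <= Dh z x - Dh z (step x).
Proof.
move=> x0 gn z0 Az; set a := alpha x.
have h : Dh z (step x) - Dh z x
    <= a ^+ 2 * locnorm2 x (g x) - a * \sum_i g x i 0 * (x i 0 - z i 0).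
  rewrite !DhE -sumrB /locnorm2 !mulr_sumr -sumrB ler_sum // => i _.
  rewrite /hd_step (negPf gn) mxE -exprMn.
  apply: le_trans (kl_hd_factor (z0 i) (x0 i) (hd_alpha_abs_le i x0 gn)) _.
  by rewrite -/a le_eqVlt; apply/orP; left; apply/eqP; ring.
move: h; rewrite (lsq_grad_inner _ Az).
have := ler_wpM2l (hd_alpha_ge0 x0 gn) (hd_alpha_locnorm2_le x0 gn).
rewrite -/a [a * (a * _)]mulrA -expr2; lra.
Qed.

(** Each branch of the minimum is treated apart: [lsq_grad_sqr_le] bounds the local norm by
    [4 M L f x], and [lsq_grad_abs_le] bounds the sup norm. *)
Lemma hd_alpha_lower_bound x z : (forall i, 0 < x i 0) -> g x != 0 ->
  (forall i, 0 <= z i 0) -> A *m z = b ->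
  1 <= 4%:R * (Dh z x + l1norm z) * L * alpha x.
Proof.
move=> x0 gn z0 Az; set M := Dh z x + l1norm z.
have D0 := Dh_ge0 z0 x0.
have xM : l1norm x <= 2 * M by exact: l1norm_le_Dh.
have zM : l1norm z <= M by rewrite lerDr.
have L0 := maxcol2_ge0 A.
have M0 : 0 <= M by rewrite addr_ge0 // l1norm_ge0.
rewrite /hd_alpha /=.
case: (leP (f x / _) _) => _; rewrite mulrA ler_pdivlMr ?mul1r //.
- rewrite (@le_trans _ _ (\sum_i x i 0 * (2 * L * f x))) //.
    apply: ler_sum => i _; rewrite ler_pM2l //; exact: lsq_grad_sqr_le.
  rewrite -mulr_suml.
  have -> : \sum_i x i 0 = l1norm x.
    by apply: eq_bigr => i _; rewrite gtr0_norm.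
  have -> : 4 * M * L * f x = 2 * M * (2 * L * f x) by ring.
  by apply: ler_wpM2r => //; apply: mulr_ge0 (lsq_f_ge0 _ _ _); rewrite mulr_ge0.
- exact: locnorm2_gt0.
- apply: bigmax_le => [|i _]; first by rewrite !mulr_ge0.
  (* With [l1norm x <= 2 M] and [l1norm z <= M] the bound is [3 L M], below [4 * 1.79 L M]. *)
  apply: le_trans (lsq_grad_abs_le x i Az) _.
  have -> : 4 * M * L * (179%:R / 100%:R) = L * (4 * M * (179%:R / 100%:R)) by ring.
  by apply: ler_wpM2l => //; lra.
- exact: supnorm_gt0.
Qed.

Lemma lsq_f_le_Dh x z : (forall i, 0 < x i 0) ->
  (forall i, 0 <= z i 0) -> A *m z = b ->
  f x <= 4%:R * (Dh z x + l1norm z) * L * (Dh z x - Dh z (step x)).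
Proof.
move=> x0 z0 Az; have [g0|gn] := eqVneq (g x) 0.
  (* Since a solution [z] exists, a stationary point already has [f x = 0], so stopping there is
     harmless. *)
  have : 2 * f x = 0.
    by rewrite -(lsq_grad_inner _ Az) big1 // => i _; rewrite g0 mxE mul0r.
  by rewrite /hd_step g0 eqxx subrr mulr0; lra.
have D0 := Dh_ge0 z0 x0.
rewrite -[f x]mul1r.
apply: le_trans (ler_wpM2r (lsq_f_ge0 A b x) (hd_alpha_lower_bound x0 gn z0 Az)) _.
rewrite -[X in X <= _]mulrA; apply: ler_wpM2l; last exact: Dh_hd_step.
by rewrite !mulr_ge0 ?maxcol2_ge0 // addr_ge0 ?l1norm_ge0.
Qed.

End Descent.

(** * Limits along filters and ultrafilters *)

Lemma cvg_sumr (R : realType) (T : Type) (F : set_system T) (I : finType)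
    (u : I -> T -> R) (l : I -> R) : Filter F ->
  (forall i, u i @ F --> l i) -> \sum_i u i t @[t --> F] --> \sum_i l i.
Proof.
by move=> FF ul; apply: cvg_big => [|i _]; [exact: add_continuous | exact: ul].
Qed.

(** Compactness gives a cluster point; it is a limit because an ultrafilter contains the preimage of
    each neighbourhood or its complement. *)
Lemma ultra_cvg_segment (R : realType) (T : Type) (U : set_system T) (u : T -> R)
    (a b : R) : UltraFilter U -> (forall t, a <= u t <= b) ->
  exists p : R, u @ U --> p.
Proof.
move=> UU uab.
have [|p [_ clp]] := @segment_compact R a b (u @ U) _.
  by apply: (@filterE _ U) => t /=; rewrite in_itv /= uab.
exists p => V Vp; case: (in_ultra_setVsetC (u @^-1` V) UU) => // UC.
by have [y [nVy Vy]] := clp (~` V) V UC Vp.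
Qed.

(** * Summed decrease and convergence of the iterates *)

Section Sequence.
Variables (R : realType) (m n : nat) (A : 'M[R]_(m, n)) (b : 'cV[R]_m).
Variable x0 : 'cV[R]_n.
Hypothesis x0_gt0 : forall i, 0 < x0 i 0.
Local Notation f := (lsq_f A b).
Local Notation L := (maxcol2 A).
Local Notation x := (hd_seq A b x0).

Lemma hd_seq_gt0 k i : 0 < x k i 0.
Proof. by elim: k i => [//|k IH] i; exact: hd_step_gt0. Qed.

Section Solution.
Variable z : 'cV[R]_n.
Hypotheses (z_ge0 : forall i, 0 <= z i 0) (Az : A *m z = b).

Lemma Dh_hd_seqS_le k : Dh z (x k.+1) <= Dh z (x k).
Proof.
have [g0|gn] := eqVneq (lsq_grad A b (x k)) 0.
  by rewrite [x k.+1]/= /hd_step g0 eqxx.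
have := Dh_hd_step (hd_seq_gt0 k) gn z_ge0 Az.
have := mulr_ge0 (hd_alpha_ge0 (hd_seq_gt0 k) gn) (lsq_f_ge0 A b (x k)).
rewrite -[x k.+1]/(hd_step A b (x k)); lra.
Qed.

Lemma Dh_hd_seq_le : nonincreasing_seq (fun k => Dh z (x k)).
Proof. by apply/nonincreasing_seqP => k; exact: Dh_hd_seqS_le. Qed.

Lemma sum_lsq_f_le k :
  \sum_(i < k) f (x i) <= 4%:R * Dh z x0 * (Dh z x0 + l1norm z) * L.
Proof.
pose C := 4%:R * (Dh z x0 + l1norm z) * L.
have L0 := maxcol2_ge0 A; have z1 := l1norm_ge0 z; have D0 := Dh_ge0 z_ge0 x0_gt0.
have C0 : 0 <= C by rewrite !mulr_ge0 // addr_ge0.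
have -> : 4%:R * Dh z x0 * (Dh z x0 + l1norm z) * L = C * Dh z x0.
  by rewrite /C; ring.
suff h : \sum_(i < k) f (x i) <= C * (Dh z x0 - Dh z (x k)).
  apply: le_trans h _; rewrite ler_wpM2l // gerBl.
  exact: Dh_ge0 z_ge0 (hd_seq_gt0 k).
elim: k => [|k IH]; first by rewrite big_ord0 subrr mulr0.
rewrite big_ord_recr /=; set y := x k.
have h := lsq_f_le_Dh (hd_seq_gt0 k) z_ge0 Az.
(* Monotonicity of the divergence freezes the coefficient at its value for [x0]. *)
have c : 4%:R * (Dh z y + l1norm z) * L <= C.
  rewrite /C ler_wpM2r // ler_wpM2l // lerD2r.
  exact: (Dh_hd_seq_le (leq0n k)).
have d : 0 <= Dh z y - Dh z (x k.+1) by rewrite subr_ge0 Dh_hd_seqS_le.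
have := le_trans h (ler_wpM2r d c).
move: IH; rewrite -/y -[hd_step A b y]/(x k.+1); lra.
Qed.

Lemma min_lsq_f_le k :
  \big[Num.min/f (x 0)]_(i < k.+1) f (x i)
    <= 4%:R * Dh z x0 * (Dh z x0 + l1norm z) * L / k.+1%:R.
Proof.
rewrite ler_pdivlMr ?ltr0n //; apply: le_trans (sum_lsq_f_le k.+1).
rewrite mulr_natr -[X in _ *+ X]card_ord -sumr_const ler_sum // => i _.
exact: bigmin_le.
Qed.

Lemma hd_seq_le k i : x k i 0 <= 2 * (Dh z x0 + l1norm z).
Proof.
have h := l1norm_le_Dh z_ge0 (hd_seq_gt0 k).
have d : Dh z (x k) <= Dh z x0 := Dh_hd_seq_le (leq0n k).
have : x k i 0 <= l1norm (x k).
  by rewrite /l1norm (bigD1 i) //= gtr0_norm ?hd_seq_gt0 // lerDl sumr_ge0.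
lra.
Qed.

Lemma cvg_lsq_f : f (x k) @[k --> \oo] --> (0 : R).
Proof.
apply: cvg_series_cvg_0; apply: nondecreasing_is_cvgn.
  by apply: nondecreasing_series => k _ _; exact: lsq_f_ge0.
eexists => _ [k _ <-]; rewrite /series /= big_mkord; exact: sum_lsq_f_le.
Qed.

End Solution.

(* Since [Dh z (x k)] is nonincreasing in [k], smallness at one index suffices. *)
Lemma cvg_hd_seq_Dh (z : 'cV[R]_n) :
  (forall i, 0 <= z i 0) -> A *m z = b ->
  (forall e, 0 < e -> exists k, Dh z (x k) < e) ->
  x k @[k --> \oo] --> (z : 'M[R]_(n, 1)).
Proof.
move=> z0 Az h; apply/cvg_ballP => e e0.
pose B := 2 * (Dh z x0 + l1norm z).
have B0 : 0 <= B by rewrite mulr_ge0 // addr_ge0 ?l1norm_ge0 ?Dh_ge0.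
have zB i : z i 0 <= B.
  rewrite (@le_trans _ _ (l1norm z)) //.
    by rewrite /l1norm (bigD1 i) //= ger0_norm // lerDl sumr_ge0.
  have := Dh_ge0 z0 x0_gt0; have := l1norm_ge0 z; rewrite /B; lra.
(* [sqdist_le_kl] with both coordinates at most [B] gives the factor [4 B]; the added 1 keeps the
   divisor positive when [B = 0]. *)
have K0 : 0 < 4 * B + 1 by lra.
have [|N hN] := h (e ^+ 2 / (4 * B + 1)); first by rewrite divr_gt0 ?exprn_gt0.
exists N => // k /= Nk; split => // i j; rewrite ord1 -ball_normE /=.
rewrite -(@ltr_pXn2r _ 2) ?nnegrE // ?ltW // real_normK ?num_real //.
rewrite -sqrrN opprB; apply: le_lt_trans (sqdist_le_kl (z0 i) (hd_seq_gt0 k i)) _.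
have lk : kl (z i 0) (x k i 0) <= Dh z (x N).
  apply: le_trans (le_Dh i z0 (hd_seq_gt0 k)) _; exact: Dh_hd_seq_le.
have k0 := kl_ge0 (z0 i) (hd_seq_gt0 k i).
have xB : x k i 0 <= B by exact: hd_seq_le.
have zi := zB i; have zi0 := z0 i; have xi0 := hd_seq_gt0 k i.
move: hN; rewrite ltr_pdivlMr //; nra.
Qed.

Lemma hd_seq_cvg_solution (z : 'cV[R]_n) :
  (forall i, 0 <= z i 0) -> A *m z = b ->
  exists xs : 'cV[R]_n, [/\ forall i, 0 <= xs i 0, A *m xs = b &
    x k @[k --> \oo] --> (xs : 'M[R]_(n, 1))].
Proof.
move=> z0 Az.
(* An ultrafilter finer than [\oo] gives all coordinates a limit at once, in place of extracting
   subsequences. *)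
have [U [UU ooU]] := @ultraFilterLemma _ (\oo : set_system nat) _.
have xU i : exists p : R, x k i 0 @[k --> U] --> p.
  apply: (@ultra_cvg_segment _ _ _ _ 0 (2 * (Dh z x0 + l1norm z))) => k.
  by rewrite ltW ?hd_seq_gt0 // hd_seq_le.
have [p xp] := choice xU; exists (\col_i p i).
have p0 i : 0 <= p i.
  by apply: (cvgr_to_ge (xp i)); apply: filterE => k; rewrite ltW ?hd_seq_gt0.
have xs0 i : 0 <= (\col_i p i) i 0 :> R by rewrite mxE.
have rU i : (A *m x k - b) i 0 @[k --> U] --> ((A *m (\col_i p i) - b) i 0 : R).
  under eq_fun => k do rewrite !mxE.
  rewrite !mxE; apply: cvgB; last exact: cvg_cst.
  by apply: cvg_sumr => j; rewrite mxE; apply: cvgM => //; exact: cvg_cst.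
have fU : f (x k) @[k --> U] --> (f (\col_i p i) : R).
  apply: (@cvgM _ _ _ _ (fun=> 2^-1 : R)); first exact: cvg_cst.
  apply: cvg_sumr => i.
  by rewrite expr2; under eq_fun do rewrite expr2; exact: cvgM.
have f0U : f (x k) @[k --> U] --> (0 : R).
  by move=> V /(cvg_lsq_f z0 Az) /ooU.
have Axs : A *m (\col_i p i) = b.
  by apply: lsq_f_eq0; exact: (cvg_unique _ fU f0U).
(* The Lyapunov function is now taken at the limit point instead of [z]; its limit 0 along [U]
   provides the small index. *)
split => //; apply: cvg_hd_seq_Dh => // e e0.
have DU : Dh (\col_i p i) (x k) @[k --> U] --> (0 : R).
  have -> : 0 = \sum_(i < n) (0 : R) by rewrite big1.
  under eq_fun do rewrite DhE.
  by apply: cvg_sumr => i; apply: cvg_kl0 => //; rewrite mxE.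
have De : \forall k \near U, `|Dh (\col_i p i) (x k)| < e.
  by apply: (cvgr0Pnorm_lt _).1.
have [k] := filter_ex De.
by move=> h; exists k; apply: le_lt_trans h; exact: ler_norm.
Qed.

End Sequence.

Theorem theorem4p2 (R : realType) (m n : nat) (A : 'M[R]_(m, n)) (b : 'cV[R]_m)
  (x0 : 'cV[R]_n) :
  (exists z : 'cV[R]_n, (forall i, 0 <= z i 0) /\ A *m z = b) ->
  (forall i, 0 < x0 i 0) ->
  exists xs : 'cV[R]_n,
    ((forall i, 0 <= xs i 0) /\ A *m xs = b) /\
    (hd_seq A b x0 x @[x --> \oo] --> (xs : 'M[R]_(n, 1))) /\
    (forall k : nat,
       \big[Num.min/lsq_f A b (hd_seq A b x0 0)]_(i < k.+1) lsq_f A b (hd_seq A b x0 i)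
       <= 4%:R * Dh xs x0 * (Dh xs x0 + l1norm xs) * maxcol2 A / k.+1%:R).
Proof.
move=> [z [z0 Az]] x0_gt0.
have [xs [xs0 Axs xxs]] := hd_seq_cvg_solution x0_gt0 z0 Az.
(* The rate holds for every nonnegative solution, in particular for the limit [xs]. *)
by exists xs; split => //; split => // k; exact: min_lsq_f_le.
Qed.
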